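(* Let $\vec G$ be a connected digraph on a linearly ordered edge set $E$, bipolar with respect to $p=\min(E)$, and let $\omega=\max(E)$. Then: (a) if $|E|=1$, then $\alpha(\vec G)=\{\omega\}$; and if $|E|>1$: (b) if $\vec G/\omega$ is bipolar w.r.t. $p$ but $\vec G\setminus\omega$ is not, then $\alpha(\vec G)=\alpha(\vec G/\omega)\cup\{\omega\}$; (c) if $\vec G\setminus\omega$ is bipolar w.r.t. $p$ but $\vec G/\omega$ is not, then $\alpha(\vec G)=\alpha(\vec G\setminus\omega)$; (d) if both $\vec G\setminus\omega$ and $\vec G/\omega$ are bipolar w.r.t. $p$, let $T'=\alpha(\vec G\setminus\omega)$, $C=C_{\vec G}(T';\omega)$ and $e=\min(C)$; if $e$ and $\omega$ have opposite signs in $C$ then $\alpha(\vec G)=\alpha(\vec G\setminus\omega)$, and if they have the same sign then $\alpha(\vec G)=\alpha(\vec G/\omega)\cup\{\omega\}$; (e) equivalently in case (d), letting $T''=\alpha(\vec G/\omega)$, $D=C^*_{\vec G}(T''\cup\{\omega\};\omega)$ and $e=\min(D)$: if $e$ and $\omega$ have opposite signs in $D$ then $\alpha(\vec G)=\alpha(\vec G/\omega)\cup\{\omega\}$, and if they have the same sign then $\alpha(\vec G)=\alpha(\vec G\setminus\omega)$.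
   Context: Graphs are finite and connected, loops and multiple edges allowed; cycles and cocycles (inclusion-minimal nonempty edge cuts) are edge subsets. For a spanning tree $T$ and $t\in T$, $C^*(T;t)$ denotes the unique cocycle contained in $(E\setminus T)\cup\{t\}$; for $e\notin T$, $C(T;e)$ denotes the unique cycle contained in $T\cup\{e\}$. In a digraph, a cycle gives two opposite signed cycles (fix a traversal direction; forward edges positive, backward negative), and a cocycle between vertex sides $(X,V\setminus X)$ gives two opposite signed cocycles (edges from $X$ to $V\setminus X$ positive, others negative). Fundamental cycles $C(T;e)$ (resp. cocycles $C^*(T;t)$) are signed so that $e$ (resp. $t$) is positive. $\vec G/\omega$ and $\vec G\setminus\omega$ denote contraction and deletion of $\omega$, with inherited orientations and order. A digraph with edge set $E$ is bipolar w.r.t. $p\in E$ if it is acyclic and has a unique source and a unique sink, which are the endpoints of $p$ (a single isthmus edge $p$ is bipolar w.r.t. $p$). For $\vec G$ on a linearly ordered edge set $E$, bipolar w.r.t. $p=\min(E)$, the fully optimal spanning tree $\alpha(\vec G)$ is the unique spanning tree $T$ such that for all $b\in T\setminus\{p\}$, $b$ and $\min(C^*(T;b))$ have opposite signs in $C^*(T;b)$, and for all $e\in E\setminus T$, $e$ and $\min(C(T;e))$ have opposite signs in $C(T;e)$ (existence and uniqueness is a known theorem). *)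

(* Defs.v *)
(* Digraphs with loops and multiple edges.
   Vertices live in an arbitrary finType V; edges are indices in 'I_m, whose
   natural order is the linear order on edges.  A digraph records its vertex
   set, its edge set, and tail/head maps.  Contraction/deletion keep the
   ambient types V and 'I_m, so orientations and order are inherited. *)
From mathcomp Require Import all_boot all_order.
Set Implicit Arguments. Unset Strict Implicit. Unset Printing Implicit Defensive.

Record digraph (V : finType) (m : nat) := Digraph {
  vset : {set V};
  eset : {set 'I_m};
  tail : 'I_m -> V;
  head : 'I_m -> V }.

Section Defs.
Variables (V : finType) (m : nat).
Implicit Types (G : digraph V m) (F T D : {set 'I_m}) (X : {set V}).

Definition wf_digraph G :=
  forall e, e \in eset G -> tail G e \in vset G /\ head G e \in vset G.

Definition adj G F : rel V := fun u v =>
  [exists e in F, ((tail G e == u) && (head G e == v))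
               || ((tail G e == v) && (head G e == u))].

Definition connected G :=
  vset G != set0 /\
  forall u v, u \in vset G -> v \in vset G -> connect (adj G (eset G)) u v.

Definition is_min F e := e \in F /\ forall f, f \in F -> e <= f.
Definition is_max F e := e \in F /\ forall f, f \in F -> f <= e.

Definition spanning_tree G T :=
  [/\ T \subset eset G,
      (forall u v, u \in vset G -> v \in vset G -> connect (adj G T) u v) &
      (forall e, e \in T -> ~~ connect (adj G (T :\ e)) (tail G e) (head G e))].

(* Signed cycles: a cycle traversed in one direction is a cyclic sequence of
   steps (e, b); b = true means e is traversed forward (tail -> head), i.e.
   e is positive; b = false means backward (negative). *)
Definition sstart G (x : 'I_m * bool) := if x.2 then tail G x.1 else head G x.1.
Definition send G (x : 'I_m * bool) := if x.2 then head G x.1 else tail G x.1.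

Definition signed_cycle_in G F (s : seq ('I_m * bool)) :=
  [/\ s != [::], all (fun x => x.1 \in F) s, uniq (map fst s),
      uniq (map (sstart G) s) & map (send G) s = map (sstart G) (rot 1 s)].

Definition cyc_edges (s : seq ('I_m * bool)) : {set 'I_m} := [set x.1 | x in s].

Definition acyclic G :=
  forall s, signed_cycle_in G (eset G) s -> ~ all (fun x => x.2) s.

Definition cut G X : {set 'I_m} :=
  [set e in eset G | (tail G e \in X) != (head G e \in X)].

Definition is_cocycle G D :=
  [/\ D != set0,
      exists2 X : {set V}, X \subset vset G & D = cut G X &
      forall X : {set V}, X \subset vset G -> cut G X != set0 -> cut G X \subset D ->
        cut G X = D].

Definition is_source G v := v \in vset G /\ forall e, e \in eset G -> head G e != v.
Definition is_sink G v := v \in vset G /\ forall e, e \in eset G -> tail G e != v.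

(* bipolar w.r.t. p: acyclic, unique source and unique sink, which are the
   endpoints of p (necessarily source = tail p, sink = head p) *)
Definition bipolar G p :=
  [/\ p \in eset G, acyclic G,
      (forall v, is_source G v <-> v = tail G p) &
      (forall v, is_sink G v <-> v = head G p)].

(* Fully optimal spanning tree (w.r.t. p = min(E)).
   In the fundamental cocycle C*(T;b), cut G X with tail b \in X makes b
   positive; an edge f of the cut is positive iff tail f \in X.
   In the fundamental cycle C(T;e), the traversal with (e,true) makes e
   positive. *)
Definition fully_optimal G T :=
  [/\ spanning_tree G T,
      (forall b, b \in T -> ~ is_min (eset G) b ->
        forall X : {set V}, X \subset vset G -> is_cocycle G (cut G X) ->
          cut G X \subset (eset G :\: T) :|: [set b] ->
          b \in cut G X -> tail G b \in X ->
          forall f, is_min (cut G X) f -> tail G f \notin X) &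
      (forall e, e \in eset G :\: T ->
        forall s, signed_cycle_in G (e |: T) s -> (e, true) \in s ->
          forall f, is_min (cyc_edges s) f -> (f, false) \in s)].

(* "alpha G = T0 ∪ ..." is expressed through the set of fully optimal trees:
   alpha_is G P  :<->  the fully optimal spanning trees of G are exactly the
   sets satisfying P. *)
Definition alpha_is G (P : {set 'I_m} -> Prop) :=
  forall T, fully_optimal G T <-> P T.

Definition delete G w : digraph V m :=
  Digraph (vset G) (eset G :\ w) (tail G) (head G).

Definition merge G w (v : V) : V := if v == head G w then tail G w else v.

Definition contract G w : digraph V m :=
  Digraph [set merge G w v | v in vset G] (eset G :\ w)
          (fun e => merge G w (tail G e)) (fun e => merge G w (head G e)).

End Defs.

(* Main.v *)
(* Give the edges rapidly decreasing weights c, with c(w) = 0. For a spanning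
   tree T, write c = u + z with u supported on T and z a circulation, and
   c = u' + dphi with u' supported off T and dphi a tension. The entries of u and
   u' are the c-values of the fundamental cocycles and cycles of T, so their signs
   are the signs of the minimal edges: T is fully optimal iff u < 0 on T minus p
   and u' < 0 off T. Circulations are orthogonal to tensions, so for two trees
   (T, u, u') and (S, v, v') we get sum (u v' + v u') = 0, where all terms are
   nonnegative, and positive where T and S differ. Hence T = S. The pairs (u, u')
   of G \ w and G / w are those of G with the sign at w left free: the same
   identity shows that if T avoids w, S contains w, and the signs are right away
   from w, then exactly one of u'(w), v(w) is negative, which decides between
   deletion and contraction. If a minor is not bipolar, the obstruction (a
   cocycle, resp. circulation, whose only negative entry is at w) is paired with
   u, resp. u', to force the sign at w. No existence theorem is needed. *)
From mathcomp Require Import all_boot all_order all_algebra zify ring.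
(* Imported last: [head] would otherwise be the one of [seq]. *)
Require Import Defs.
Set Implicit Arguments. Unset Strict Implicit. Unset Printing Implicit Defensive.
Import Order.TTheory GRing.Theory Num.Theory.

(** * Potentials, tensions, cuts and spanning trees *)

Section Potentials.
Local Open Scope ring_scope.
Variables (V : finType) (m : nat).
Implicit Types (G : digraph V m) (F T : {set 'I_m}) (X : {set V}) (phi : V -> int).

(** The sign makes the tension of the indicator of [X] equal to 1 on edges leaving [X], the positive
    elements of the signed cut. *)
Definition dpot G phi e : int := phi (tail G e) - phi (head G e).

Definition ind X v : int := (v \in X)%:R.

Definition comp G F u : {set V} := [set v in vset G | connect (adj G F) u v].

Lemma adj_edge G F e : e \in F -> adj G F (tail G e) (head G e).
Proof. by move=> eF; apply/existsP; exists e; rewrite eF !eqxx. Qed.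

Lemma adj_sym G F : symmetric (adj G F).
Proof. by move=> u v; apply: eq_existsb => e; rewrite orbC. Qed.

Lemma connect_pot G F phi u v :
  (forall e, e \in F -> dpot G phi e = 0) -> connect (adj G F) u v ->
  phi u = phi v.
Proof.
move=> phi0 /connectP[q]; elim: q u => [|x q IH] u /=; first by move=> _ ->.
case/andP=> /existsP[e /andP[eF uxE]] qP vE; rewrite -(IH x qP vE).
by move/eqP: (phi0 e eF); rewrite subr_eq0 => /eqP;
   case/orP: uxE => /andP[/eqP-> /eqP->].
Qed.

Lemma mem_cut G X e : (e \in cut G X) = (e \in eset G) && (dpot G (ind X) e != 0).
Proof. by rewrite inE /dpot /ind subr_eq0; do 2!case: (_ \in X). Qed.

Lemma dpot_ind_in G X e : e \in cut G X -> tail G e \in X -> dpot G (ind X) e = 1.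
Proof. by rewrite inE /dpot /ind => /andP[_] /[swap] ->; case: (_ \in X). Qed.

Lemma dpot_ind_notin G X e :
  e \in cut G X -> tail G e \notin X -> dpot G (ind X) e = -1.
Proof.
by rewrite inE /dpot /ind => /andP[_] /[swap] /negPf->; case: (_ \in X).
Qed.

Lemma dpot_ind_norm G X e : `|dpot G (ind X) e| <= 1.
Proof. by rewrite /dpot /ind; do 2!case: (_ \in X). Qed.

Lemma dpot_comp G F u e : wf_digraph G -> F \subset eset G -> e \in F ->
  dpot G (ind (comp G F u)) e = 0.
Proof.
move=> wfG /subsetP FE eF; have [tV hV] := wfG e (FE e eF).
rewrite /dpot /ind !inE tV hV /=; apply/eqP; rewrite subr_eq0; apply/eqP.
congr (nat_of_bool _)%:R; apply/idP/idP => uP; apply: (connect_trans uP);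
  apply: connect1; last rewrite adj_sym.
all: exact: adj_edge.
Qed.

(** Spanning trees without paths: tensions are determined by their values on [T], and these values
    are free. This form passes easily through a contraction, whose potentials are those of [G] with
    zero tension at [w]. *)
Definition tree_pot G T :=
  [/\ T \subset eset G,
      forall phi, (forall e, e \in T -> dpot G phi e = 0) ->
        forall u v, u \in vset G -> v \in vset G -> phi u = phi v &
      forall b, b \in T -> exists2 phi, dpot G phi b = 1 &
        forall e, e \in T -> e != b -> dpot G phi e = 0].

Lemma tree_cut G T b (X := comp G (T :\ b) (tail G b)) :
  wf_digraph G -> spanning_tree G T -> b \in T ->
  [/\ X \subset vset G, tail G b \in X, dpot G (ind X) b = 1 &
      forall e, e \in T -> e != b -> dpot G (ind X) e = 0].
Proof.
move=> wfG [TE _ indT] bT; have [tV hV] := wfG b (subsetP TE b bT).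
have tX : tail G b \in X by rewrite inE tV connect0.
split=> //; first by apply/subsetP => v; rewrite inE => /andP[].
  by rewrite /dpot /ind tX [head G b \in X]inE hV (negPf (indT b bT)).
move=> e eT eb; apply: dpot_comp => //; last by rewrite !inE eb.
exact: subset_trans (subsetDl _ _) TE.
Qed.

Lemma spanning_treeP G T : wf_digraph G -> spanning_tree G T <-> tree_pot G T.
Proof.
move=> wfG; split=> [sT|[TE constT indT]].
  have [TE conT _] := sT; split=> //.
    by move=> phi phi0 u v uV vV; apply: connect_pot phi0 _; apply: conT.
  by move=> b bT; have [_ _ X1 X0] := tree_cut wfG sT bT;
    exists (ind (comp G (T :\ b) (tail G b))).
split=> //.
  move=> u v uV vV; have := constT (ind (comp G T u)).
  move=> /(_ (fun e => @dpot_comp G T u e wfG TE) u v uV vV).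
  by rewrite /ind !inE uV vV connect0 /=; case: connect.
move=> b bT; have [phi phi1 phi0] := indT b bT; apply/negP => tb.
have phi_tb : phi (tail G b) = phi (head G b).
  apply: connect_pot tb => e; rewrite !inE => /andP[eb eT]; exact: phi0.
by move: phi1; rewrite /dpot phi_tb subrr.
Qed.

End Potentials.

(** * Signed cycles and directed reachability *)

Section Cycles.
Local Open Scope ring_scope.
Variables (V : finType) (m : nat).
Implicit Types (G : digraph V m) (F T : {set 'I_m}) (X : {set V}) (phi : V -> int).
Implicit Types (s : seq ('I_m * bool)).

Definition sgb (b : bool) : int := if b then 1 else -1.

Definition cyc_vec s e : int := ((e, true) \in s)%:R - ((e, false) \in s)%:R.

Lemma cyc_vec_norm s e : `|cyc_vec s e| <= 1.
Proof. by rewrite /cyc_vec; do 2!case: (_ \in s). Qed.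

Lemma mem_cyc_edges s e : (e \in cyc_edges s) = (e \in map fst s).
Proof.
apply/imsetP/mapP => [[x xs ->]|[x xs ->]]; by exists x.
Qed.

Lemma uniq_fst_inj s e b : uniq (map fst s) -> (e, b) \in s -> (e, ~~ b) \notin s.
Proof.
elim: s => [|[f c] s IH] //= /andP[fs us]; rewrite !inE !xpair_eqE.
case/orP=> [/andP[/eqP-> /eqP->]|ebs].
  rewrite eqxx /= negb_or; apply/andP; split; first by case: c.
  by apply: contra fs => fcs; apply/mapP; exists (f, ~~ c).
rewrite negb_or (IH us ebs) andbT; case: eqP => //= ef.
by case/negP: fs; rewrite -ef; apply/mapP; exists (e, b).
Qed.

Lemma cyc_vec_mem s e b : uniq (map fst s) -> (e, b) \in s -> cyc_vec s e = sgb b.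
Proof.
move=> us ebs; have := uniq_fst_inj us ebs; rewrite /cyc_vec.
by case: b ebs => /= -> /negPf->.
Qed.

Lemma cyc_vec_supp s e : cyc_vec s e != 0 -> e \in cyc_edges s.
Proof.
rewrite mem_cyc_edges /cyc_vec => H; apply/mapP.
case Et: ((e, true) \in s); first by exists (e, true).
case Ef: ((e, false) \in s); first by exists (e, false).
by rewrite Et Ef in H.
Qed.

Lemma cyc_edgesP s e : e \in cyc_edges s -> exists b, (e, b) \in s.
Proof. by rewrite mem_cyc_edges => /mapP[[f b] fs ->]; exists b. Qed.

Lemma sum_cyc_vec s F (a : 'I_m -> int) :
  uniq (map fst s) -> all (fun x => x.1 \in F) s ->
  \sum_(e in F) cyc_vec s e * a e = \sum_(x <- s) sgb x.2 * a x.1.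
Proof.
move=> us /allP sF; rewrite big_uniq ?(map_uniq us) //=.
rewrite (eq_bigr (fun e => \sum_(b : bool | (e, b) \in s) sgb b * a e)); last first.
  move=> e _; rewrite -mulr_suml big_mkcond big_bool /= /cyc_vec /sgb.
  by case: (_ \in s); case: (_ \in s).
rewrite pair_big_dep /=; apply: eq_bigl => -[e b] /=.
by apply: andb_idl => /sF.
Qed.

(** Each step contributes the potential at its start minus that at its end, and the ends are the
    starts up to rotation. *)
Lemma sum_cyc_dpot G F s phi : signed_cycle_in G F s ->
  \sum_(e in F) cyc_vec s e * dpot G phi e = 0.
Proof.
case=> _ sF us _ ends; rewrite sum_cyc_vec //.
rewrite (eq_bigr (fun x => phi (sstart G x) - phi (send G x))); last first.
  by case=> e [] _; rewrite /sgb /dpot /sstart /send /= ?mul1r // mulN1r opprB.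
rewrite sumrB; have big_ends (r : seq ('I_m * bool)) f :
    \sum_(x <- r) phi (f x) = \sum_(v <- map f r) phi v by rewrite big_map.
rewrite !big_ends ends map_rot [X in _ - X](perm_big (map (sstart G) s)) ?subrr //.
by rewrite perm_rot.
Qed.

(* A step sequence along a simple path never uses an edge twice: the second use
   would start or end at a vertex already visited. *)
Lemma path_steps G (r : rel V) (P : pred ('I_m * bool)) u q :
  (forall x y, r x y -> exists z, [/\ P z, sstart G z = x & send G z = y]) ->
  path r u q -> uniq (u :: q) ->
  exists s, [/\ all P s, map (sstart G) s = belast u q, map (send G) s = q &
                uniq (map fst s)].
Proof.
move=> rP; elim: q u => [|v q IH] u; first by exists [::].
rewrite [path _ _ _]/= [uniq _]/= => /andP[uv qP] /andP[uvq uq].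
have [s [Ps ss se us]] := IH v qP uq; have [z [Pz zs ze]] := rP u v uv.
exists (z :: s); rewrite /= Pz Ps zs ze ss se us !andbT; split=> //.
apply/mapP => -[y ys zy]; case/negP: uvq.
have : (sstart G y == u) || (send G y == u).
  move: zs; rewrite /sstart /send zy.
  by case: (z.2); case: (y.2) => ->; rewrite eqxx ?orbT.
case/orP => /eqP <-.
  by apply: mem_belast; rewrite -ss map_f.
by rewrite inE -se map_f ?orbT.
Qed.

Lemma closed_steps G F e q s :
  e \in F -> all (fun x => x.1 \in F) s -> last (head G e) q = tail G e ->
  uniq (head G e :: q) -> map (sstart G) s = belast (head G e) q ->
  map (send G) s = q -> uniq (map fst ((e, true) :: s)) ->
  signed_cycle_in G F ((e, true) :: s).
Proof.
move=> eF sF lq uq ss se us; split=> //=; first by rewrite eF.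
  rewrite ss /sstart /= -lq; move: uq; rewrite lastI rcons_uniq.
  by case/andP => -> ->.
by rewrite rot1_cons map_rcons ss se /send /sstart /= -lq -lastI.
Qed.

Lemma fundamental_cycle G T e : wf_digraph G -> spanning_tree G T ->
  e \in eset G :\: T ->
  exists2 s, signed_cycle_in G (e |: T) s & (e, true) \in s.
Proof.
move=> wfG [_ conT _]; rewrite inE => /andP[eT eE]; have [tV hV] := wfG e eE.
have /connectP[q0 q0P lq0] := conT _ _ hV tV.
case/shortenP: q0P lq0 => q qP uq _ lq {q0}.
have stepT x y : adj G T x y -> exists z,
    [/\ z.1 \in T, sstart G z = x & send G z = y].
  case/existsP=> f /andP[fT /orP[]/andP[/eqP<- /eqP<-]].
    by exists (f, true).
  by exists (f, false).
have [s [sT ss se us]] := path_steps (P := fun z => z.1 \in T) stepT qP uq.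
exists ((e, true) :: s); last by rewrite mem_head.
apply: (closed_steps _ _ (esym lq) uq ss se _); first by rewrite setU11.
  by apply: sub_all sT => z; rewrite inE orbC => ->.
rewrite /= us andbT; apply: contra eT => /mapP[z zs ->].
exact: (allP sT).
Qed.

Lemma acyclic_potential G : acyclic G ->
  exists phi : V -> int, forall e, e \in eset G -> 0 < dpot G phi e.
Proof.
move=> acG.
pose r u v := [exists e in eset G, (tail G e == u) && (head G e == v)].
(* The potential counts the vertices reachable by directed paths; it drops along [e] because
   [tail G e] is not reachable from [head G e]. *)
exists (fun v => (#|connect r v|)%:R) => e eE.
have r_e : r (tail G e) (head G e) by apply/existsP; exists e; rewrite eE !eqxx.
rewrite /dpot subr_gt0 ltr_nat; apply: proper_card; apply/properP; split.
  by apply/subsetP => v; apply: connect_trans; apply: connect1.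
exists (tail G e); first exact: connect0.
apply/negP => /connectP[q0 q0P lq0].
case/shortenP: q0P lq0 => q qP uq _ lq {q0}.
pose P (z : 'I_m * bool) := (z.1 \in eset G) && z.2.
have stepP x y : r x y -> exists z, [/\ P z, sstart G z = x & send G z = y].
  by case/existsP=> f /and3P[fE /eqP<- /eqP<-]; exists (f, true); rewrite /P fE.
have [s [sP ss se us]] := path_steps stepP qP uq.
have sE : all (fun x => x.1 \in eset G) s by apply: sub_all sP => z /andP[].
have spos : all (fun x => x.2) s by apply: sub_all sP => z /andP[].
suff /acG : signed_cycle_in G (eset G) ((e, true) :: s) by rewrite /= spos; apply.
apply: (closed_steps _ _ (esym lq) uq ss se _) => //=; rewrite us andbT.
(* A second use of [e] would be a forward step starting at the last vertex of the simple path. *)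
apply/mapP => -[z zs ez]; move: uq; rewrite lastI rcons_uniq -lq -ss => /andP[/negP[]].
by apply/mapP; exists z => //; rewrite /sstart (allP spos z zs) -ez.
Qed.

End Cycles.

(** * Weights and certificates of optimality *)

Section Optimality.
Local Open Scope ring_scope.
Variables (V : finType) (m : nat).
Implicit Types (G : digraph V m) (F T : {set 'I_m}) (X : {set V}) (phi : V -> int).
Implicit Types (s : seq ('I_m * bool)).

(* Each weight exceeds the sum of the weights of all larger edges; the value at
   [w] and, by truncated subtraction, beyond it is 0. *)
Definition weight (w f : 'I_m) : int := (2 ^ (w - f))%N%:Z - 1.

Lemma weight_ge0 (w f : 'I_m) : 0 <= weight w f.
Proof. by rewrite /weight subr_ge0 lez_nat expn_gt0. Qed.

Lemma weight_eq0 (w f : 'I_m) : (w <= f)%N -> weight w f = 0.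
Proof. by rewrite /weight -subn_eq0 => /eqP->. Qed.

Lemma weight_gt0 (w f : 'I_m) : (f < w)%N -> 0 < weight w f.
Proof.
rewrite -subn_gt0 /weight subr_gt0 => fw.
by rewrite ltz_nat -{1}(expn0 2) ltn_exp2l.
Qed.

Lemma weight_dom (w f : 'I_m) : (f < w)%N ->
  \sum_(g < m | (f < g)%N) weight w g < weight w f.
Proof.
(* For [n < w] the bound is the exact value of the sum up to [w], beyond which terms vanish. The
   extra [w - n], at least 1 for [n = f], yields strictness. *)
move=> fw; have bound k n : \sum_(n.+1 <= i < n.+1 + k) ((2 ^ (w - i))%N%:Z - 1) <=
    (2 ^ (w - n))%N%:Z - 1 - (w - n)%N%:Z.
  elim: k n => [|k IH] n.
    rewrite addn0 big_geq //; have := ltn_expl (w - n) (ltnSn 1); lia.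
  rewrite big_ltn ?addnS ?ltnS ?leq_addr // -addSn; have := IH n.+1.
  case: (leqP w n) => [wn|nw].
    have -> : (w - n.+1 = 0)%N by lia.
    have -> : (w - n = 0)%N by lia.
    by move: (bigop.body _ _ _) => S; rewrite expn0; lia.
  have -> : (w - n = (w - n.+1).+1)%N by lia.
  rewrite expnS; move: (bigop.body _ _ _) (2 ^ (w - n.+1))%N => S N; lia.
have := bound (m - f.+1)%N f; rewrite subnKC // => bf.
rewrite -(big_mkord (fun g => f < g)%N (fun g => (2 ^ (w - g))%N%:Z - 1)).
rewrite (@big_cat_nat _ _ _ f.+1) //= big_nat_cond big1 ?add0r; last by case=> [|i]; lia.
rewrite big_nat_cond (eq_bigl (fun i => (f.+1 <= i < m) && true)%N) -?big_nat_cond;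
  last by move=> i; lia.
by apply: le_lt_trans bf _; rewrite /weight; lia.
Qed.

(** With entries in {-1, 0, 1}, the term of the smallest edge of the support outweighs all the
    others together, so it decides the sign of the sum. *)
Lemma sum_lead_bound (w f : 'I_m) F (a : 'I_m -> int) : f \in F -> (f < w)%N ->
  (forall g, `|a g| <= 1) -> (forall g, g \in F -> a g != 0 -> (f <= g)%N) ->
  `|\sum_(g in F) a g * weight w g - a f * weight w f| < weight w f.
Proof.
move=> fF fw a1 fmin; rewrite (bigD1 f) //= addrAC subrr add0r.
apply: le_lt_trans (weight_dom fw); apply: le_trans (ler_norm_sum _ _ _) _.
rewrite [leLHS]big_mkcond [leRHS]big_mkcond; apply: ler_sum => g _ /=.
rewrite normrM (ger0_norm (weight_ge0 _ _)).
have := weight_ge0 w g; case: (boolP (g \in F)) => /= gF; last by case: ifP.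
case: (eqVneq (a g) 0) => [->|ag0]; first by rewrite normr0 mul0r; do 2!case: ifP.
have := fmin g gF ag0; rewrite -(inj_eq val_inj) /= [(f <= g)%N]leq_eqVlt eq_sym.
case: eqP => /= [_ _|_ ->] W; first by case: ifP.
by rewrite -[leRHS]mul1r ler_wpM2r.
Qed.

(** The inequality is not strict: the support may start at [w], and then the sum is 0. This can
    happen for the fundamental cut or cycle of [w] itself. *)
Lemma sum_lead_ge0 (w f : 'I_m) F (a : 'I_m -> int) : f \in F ->
  (forall g, `|a g| <= 1) -> (forall g, g \in F -> a g != 0 -> (f <= g)%N) ->
  a f = 1 -> 0 <= \sum_(g in F) a g * weight w g.
Proof.
move=> fF a1 fmin af; case: (ltnP f w) => [fw|wf].
  by have := sum_lead_bound fF fw a1 fmin; rewrite af; lia.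
rewrite big1 // => g gF; case: (eqVneq (a g) 0) => [->|/(fmin g gF) fg].
  by rewrite mul0r.
by rewrite weight_eq0 ?mulr0 // (leq_trans wf).
Qed.

Lemma sum_lead_lt0 (w f : 'I_m) F (a : 'I_m -> int) : f \in F -> (f < w)%N ->
  (forall g, `|a g| <= 1) -> (forall g, g \in F -> a g != 0 -> (f <= g)%N) ->
  a f = -1 -> \sum_(g in F) a g * weight w g < 0.
Proof.
by move=> fF fw a1 fmin af; have := sum_lead_bound fF fw a1 fmin; rewrite af; lia.
Qed.

Lemma ex_is_min F (e : 'I_m) : e \in F -> exists f, is_min F f.
Proof.
move=> eF; case: (arg_minnP (fun f : 'I_m => val f) eF) => f fF fmin.
by exists f; split.
Qed.

Lemma dpot_sum G (I : finType) (P : pred I) (a : I -> int) (f : I -> V -> int) e :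
  dpot G (fun v => \sum_(i | P i) a i * f i v) e = \sum_(i | P i) a i * dpot G (f i) e.
Proof. by rewrite /dpot -sumrB; apply: eq_bigr => i _; rewrite mulrBr. Qed.

Lemma dpotB G phi psi e : dpot G (fun v => phi v - psi v) e = dpot G phi e - dpot G psi e.
Proof. by rewrite /dpot; lia. Qed.

Lemma tree_pot_eq G T phi psi e : wf_digraph G -> spanning_tree G T ->
  (forall b, b \in T -> dpot G phi b = dpot G psi b) -> e \in eset G ->
  dpot G phi e = dpot G psi e.
Proof.
move=> wfG /(spanning_treeP _ wfG)[_ constT _] eqT eE; have [tV hV] := wfG e eE.
have : phi (tail G e) - psi (tail G e) = phi (head G e) - psi (head G e).
  apply: (constT (fun v => phi v - psi v)) tV hV => b bT.
  by rewrite dpotB eqT // subrr.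
by rewrite /dpot; lia.
Qed.

Section Certificates.
Variables (G : digraph V m) (p w : 'I_m).

(** Orthogonality to every tension says that [weight w - u] is a circulation. *)
Definition primal T (u : 'I_m -> int) :=
  (forall phi, \sum_(e in eset G) u e * dpot G phi e =
               \sum_(e in eset G) weight w e * dpot G phi e) /\
  (forall e, e \in eset G -> e \notin T -> u e = 0).

(** The part [u'] of the weight supported off [T] is [weight w - dpot G phi]; it is kept implicit in
    [phi]. *)
Definition dual T phi := forall e, e \in T -> dpot G phi e = weight w e.

Definition opt_at T (u : 'I_m -> int) phi e :=
  if e \in T then u e < 0 else weight w e < dpot G phi e.

(* Certificate of full optimality, up to the condition at [w]. *)
Definition near_opt T u phi :=
  [/\ spanning_tree G T /\ p \in T, primal T u, dual T phi &
      forall e, e \in eset G -> e != p -> e != w -> opt_at T u phi e].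

Hypothesis wfG : wf_digraph G.

(** [u b] pairs the weight with the fundamental cut of [b]. Every tension combines the fundamental
    cuts with its own values on [T] as coefficients, and exchanging the sums gives the circulation
    condition. *)
Lemma tree_certificate T : spanning_tree G T -> exists u phi, primal T u /\ dual T phi.
Proof.
move=> sT; have [TE _ _] := sT.
pose X b := ind (comp G (T :\ b) (tail G b)).
have X1 b : b \in T -> dpot G (X b) b = 1 by case/(tree_cut wfG sT).
have X0 b e : b \in T -> e \in T -> e != b -> dpot G (X b) e = 0.
  by case/(tree_cut wfG sT) => _ _ _; apply.
have expT (a : 'I_m -> int) e : e \in T ->
    dpot G (fun v => \sum_(b in T) a b * X b v) e = a e.
  move=> eT; rewrite dpot_sum (bigD1 e) //= X1 // mulr1 big1 ?addr0 // => b /andP[bT be].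
  by rewrite X0 ?mulr0 // eq_sym.
exists (fun b => if b \in T then \sum_(e in eset G) weight w e * dpot G (X b) e else 0).
exists (fun v => \sum_(b in T) weight w b * X b v); split; last by move=> e; apply: expT.
split=> [psi|e _ /negPf-> //].
rewrite [RHS](eq_bigr (fun e => \sum_(b in T)
    weight w e * (dpot G psi b * dpot G (X b) e))); last first.
  move=> e eE; rewrite -mulr_sumr -dpot_sum; congr (_ * _).
  by apply: tree_pot_eq sT _ eE => // b bT; rewrite expT.
rewrite exchange_big /= (big_setID T) /= (setIidPr TE) [X in _ + X]big1 ?addr0.
  apply: eq_bigr => b bT; rewrite bT mulr_suml; apply: eq_bigr => e _.
  by rewrite -mulrA [X in _ * X]mulrC.
by move=> e; rewrite inE => /andP[/negPf-> _]; rewrite mul0r.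
Qed.

(** The cut is orthogonal to [weight w - u], and [u] lives on [T], which the cut meets at most in
    [b]; one term remains. *)
Lemma cut_value T u X b : primal T u -> b \in eset G -> cut G X :&: T \subset [set b] ->
  \sum_(e in eset G) dpot G (ind X) e * weight w e = u b * dpot G (ind X) b.
Proof.
case=> circ supp bE /subsetP cutT.
under eq_bigr do rewrite mulrC.
rewrite -circ (bigD1 b) //= big1 ?addr0 // => e /andP[eE eb].
case: (boolP (e \in T)) => [eT|/(supp e eE)->]; last by rewrite mul0r.
apply/eqP; rewrite mulf_eq0; apply/orP; right; apply: contraR eb => e0.
by have := cutT e; rewrite in_setI in_set1 mem_cut eE e0 eT; apply.
Qed.

(** Dually, the cycle is orthogonal to the tension of [phi], which equals the weight on [T], so only
    the term of [e] remains. *)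
Lemma cycle_value T phi s e : T \subset eset G -> dual T phi -> e \in eset G ->
  signed_cycle_in G (e |: T) s -> (e, true) \in s ->
  \sum_(f in eset G) cyc_vec s f * weight w f = weight w e - dpot G phi e.
Proof.
move=> TE dualT eE cs es; have [snil sT us ss ends] := cs.
have sE : all (fun x => x.1 \in eset G) s.
  apply: sub_all sT => x; rewrite !inE => /orP[/eqP-> //|]; exact: (subsetP TE).
have csE : signed_cycle_in G (eset G) s by split.
have <- : \sum_(f in eset G) cyc_vec s f * weight w f -
    \sum_(f in eset G) cyc_vec s f * dpot G phi f =
    \sum_(f in eset G) cyc_vec s f * weight w f.
  by rewrite (sum_cyc_dpot phi csE) subr0.
rewrite -sumrB.
rewrite (bigD1 e) //= -mulrBr (cyc_vec_mem us es) mul1r big1 ?addr0 // => f /andP[fE fe].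
case: (boolP (f \in T)) => [/dualT->|fT]; first by rewrite subrr.
rewrite -mulrBr; apply/eqP; rewrite mulf_eq0; apply/orP; left.
apply: contraR fT => /cyc_vec_supp/cyc_edgesP[c fs].
by have := allP sT _ fs; rewrite !inE (negPf fe).
Qed.

End Certificates.
End Optimality.

(** * Full optimality as a sign condition on certificates *)

Section FullyOptimal.
Local Open Scope ring_scope.
Variables (V : finType) (m : nat) (G : digraph V m) (p w : 'I_m).
Implicit Types (F T : {set 'I_m}) (X : {set V}) (phi : V -> int).
Implicit Types (s : seq ('I_m * bool)).
Hypothesis wfG : wf_digraph G.

Lemma dpotZ k phi e : dpot G (fun v => k * phi v) e = k * dpot G phi e.
Proof. by rewrite /dpot mulrBr. Qed.

Lemma fundamental_cut T b : spanning_tree G T -> b \in T ->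
  exists X, [/\ X \subset vset G, is_cocycle G (cut G X),
    cut G X \subset (eset G :\: T) :|: [set b], b \in cut G X & tail G b \in X].
Proof.
move=> sT bT; have [TE _ _] := sT; have [XV tX X1 X0] := tree_cut wfG sT bT.
have bX : b \in cut G (comp G (T :\ b) (tail G b)).
  by rewrite mem_cut X1 (subsetP TE).
exists (comp G (T :\ b) (tail G b)); split=> //; last first.
  apply/subsetP => e; rewrite mem_cut !inE => /andP[eE e0]; rewrite eE andbT.
  by case: (boolP (e \in T)) => //= eT; apply: contraR e0 => /(X0 e eT)->.
split; first by apply/set0Pn; exists b.
  by exists (comp G (T :\ b) (tail G b)).
move=> Y YV /set0Pn[f fY] /subsetP YX.
(* A cut inside the fundamental cut of [b] agrees on [T] with a multiple of it. *)
have Yk e : e \in eset G -> dpot G (ind Y) e =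
    dpot G (ind Y) b * dpot G (ind (comp G (T :\ b) (tail G b))) e.
  move=> eE; rewrite -dpotZ; apply: (tree_pot_eq wfG sT) eE => c cT; rewrite dpotZ.
  case: (eqVneq c b) => [->|cb]; first by rewrite X1 mulr1.
  rewrite X0 // mulr0; apply/eqP/negPn/negP => c0; have := YX c.
  by rewrite !mem_cut c0 (X0 c) // eqxx (subsetP TE) //= => /(_ isT).
have k0 : dpot G (ind Y) b != 0.
  by move: fY; rewrite mem_cut => /andP[fE]; rewrite Yk // mulf_eq0 negb_or => /andP[].
apply/setP => e; rewrite !mem_cut; case: (boolP (e \in eset G)) => //= eE.
by rewrite Yk // mulf_eq0 (negPf k0).
Qed.

Lemma tree_cut_value T u X b : primal G w T u ->
  cut G X \subset (eset G :\: T) :|: [set b] -> b \in cut G X -> tail G b \in X ->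
  \sum_(e in eset G) dpot G (ind X) e * weight w e = u b.
Proof.
move=> prT cutT bX tX; rewrite (@cut_value _ _ _ _ T u X b) //.
- by rewrite dpot_ind_in ?mulr1.
- by move: bX; rewrite mem_cut => /andP[].
apply/subsetP => e; rewrite in_setI => /andP[/(subsetP cutT)]; rewrite !inE.
by case: (e \in T).
Qed.

Lemma min_cut_dpot X f e : is_min (cut G X) f -> e \in eset G ->
  dpot G (ind X) e != 0 -> (f <= e)%N.
Proof. by case=> _ fmin eE e0; apply: fmin; rewrite mem_cut eE. Qed.

Lemma min_cut_eset X f : is_min (cut G X) f -> f \in eset G.
Proof. by case; rewrite mem_cut => /andP[]. Qed.

Lemma cut_value_ge0 T u X b f : primal G w T u ->
  cut G X \subset (eset G :\: T) :|: [set b] -> b \in cut G X -> tail G b \in X ->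
  is_min (cut G X) f -> tail G f \in X -> 0 <= u b.
Proof.
move=> prT cutT bX tX fmin tf; rewrite -(tree_cut_value prT cutT bX tX).
apply: (sum_lead_ge0 _ (a := dpot G (ind X)) (min_cut_eset fmin)) => [g|g|].
- exact: dpot_ind_norm.
- exact: min_cut_dpot.
by rewrite dpot_ind_in //; case: fmin.
Qed.

Lemma cut_value_lt0 T u X (b f : 'I_m) : primal G w T u -> (b <= w)%N ->
  cut G X \subset (eset G :\: T) :|: [set b] -> b \in cut G X -> tail G b \in X ->
  is_min (cut G X) f -> tail G f \notin X -> u b < 0.
Proof.
move=> prT bw cutT bX tX fmin tf; rewrite -(tree_cut_value prT cutT bX tX).
apply: (sum_lead_lt0 (a := dpot G (ind X)) (min_cut_eset fmin)) => [|g|g|]; last 1 first.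
- by rewrite dpot_ind_notin //; case: fmin.
(* The minimum [f] has the sign opposite to [b], so [f < b <= w] and its weight is positive. *)
- apply: leq_trans bw; rewrite ltn_neqAle; have [_ ->] := fmin; rewrite // andbT.
  by apply: contraNneq tf => /val_inj->.
- exact: dpot_ind_norm.
- exact: min_cut_dpot.
Qed.

Lemma min_cyc_vec s f e : is_min (cyc_edges s) f -> cyc_vec s e != 0 -> (f <= e)%N.
Proof. by case=> _ fmin /cyc_vec_supp; apply: fmin. Qed.

Section CycleValue.
Variables (T : {set 'I_m}) (phi : V -> int) (s : seq ('I_m * bool)) (e f : 'I_m).
Hypotheses (TE : T \subset eset G) (dualT : dual G w T phi) (eE : e \in eset G).
Hypotheses (cs : signed_cycle_in G (e |: T) s) (es : (e, true) \in s).
Hypothesis fmin : is_min (cyc_edges s) f.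

Let fE : f \in eset G.
Proof.
have [_ sT _ _ _] := cs; have [/cyc_edgesP[b fs] _] := fmin.
by have := allP sT _ fs; rewrite !inE /= => /orP[/eqP->|/(subsetP TE)].
Qed.

Lemma cycle_value_ge0 : (f, true) \in s -> dpot G phi e <= weight w e.
Proof.
have [_ _ us _ _] := cs => fs; rewrite -subr_ge0 -(cycle_value TE dualT eE cs es).
apply: (sum_lead_ge0 _ (a := cyc_vec s) fE) => [g|g _|]; first exact: cyc_vec_norm.
  exact: min_cyc_vec.
exact: (cyc_vec_mem us fs).
Qed.

Lemma cycle_value_lt0 : (e <= w)%N -> (f, false) \in s -> weight w e < dpot G phi e.
Proof.
have [_ _ us _ _] := cs => ew fs; rewrite -subr_lt0 -(cycle_value TE dualT eE cs es).
apply: (sum_lead_lt0 (a := cyc_vec s) fE) => [|g|g _|]; last 1 first.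
- exact: (cyc_vec_mem us fs).
(* No edge is used in both directions, so [f] differs from [e] and [f < e <= w]. *)
- apply: leq_trans ew; rewrite ltn_neqAle; have [_ fle] := fmin.
  rewrite fle ?mem_cyc_edges ?andbT; last by apply/mapP; exists (e, true).
  by apply: contraTneq fs => /val_inj->; apply: (uniq_fst_inj us es).
- exact: cyc_vec_norm.
- exact: min_cyc_vec.
Qed.

End CycleValue.

Lemma cyc_edges_min s e : (e, true) \in s -> exists f, is_min (cyc_edges s) f.
Proof.
move=> es; apply: (@ex_is_min m _ e); rewrite mem_cyc_edges.
by apply/mapP; exists (e, true).
Qed.

(** Outside [T], [p] would be the minimum of its own fundamental cycle and would have to be opposite
    to itself. *)
Lemma fully_optimal_min T : is_min (eset G) p -> fully_optimal G T -> p \in T.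
Proof.
case=> pE pmin [sT _ optC]; have [TE _ _] := sT; apply: contraT => pT.
have peT : p \in eset G :\: T by rewrite inE pT.
have [s cs ps] := fundamental_cycle wfG sT peT; have [_ sF us _ _] := cs.
have /(optC p peT s cs ps) : is_min (cyc_edges s) p.
  split=> [|f /cyc_edgesP[b fs]].
    by rewrite mem_cyc_edges; apply/mapP; exists (p, true).
  by have := allP sF _ fs; rewrite !inE /= => /orP[/eqP-> //|/(subsetP TE)/pmin].
by rewrite (negPf (uniq_fst_inj us ps)).
Qed.

(** A minimum of opposite sign makes the value of a fundamental cut or cycle negative, one of equal
    sign makes it nonnegative. As [w] bounds the edges but may be absent, the criterion also serves
    the minors, where the condition at [w] is void. *)
Lemma fully_optimalP T : is_min (eset G) p -> (forall e, e \in eset G -> (e <= w)%N) ->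
  fully_optimal G T <-> exists u phi, near_opt G p w T u phi /\
    (w \in eset G -> w != p -> opt_at G w T u phi w).
Proof.
move=> pm wmax; split=> [optT|[u [phi [[[sT pT] prT duT opt] optw]]]].
  have pT := fully_optimal_min pm optT; have [sT optD optC] := optT.
  have [TE _ _] := sT; have [u [phi [prT duT]]] := tree_certificate w wfG sT.
  exists u, phi; suff opt e : e \in eset G -> e != p -> opt_at G w T u phi e.
    by split=> [|wE wp]; [split=> // e eE ep _|]; apply: opt.
  move=> eE ep; rewrite /opt_at; case: ifPn => [eT|eT].
    have [X [XV cX cutT eX tX]] := fundamental_cut sT eT.
    have [f fmin] := ex_is_min eX.
    apply: (cut_value_lt0 prT (wmax e eE) cutT eX tX fmin).
    apply: (optD e eT _ X XV cX cutT eX tX f fmin) => -[_ emin].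
    case/eqP: ep; apply/val_inj/eqP; rewrite eqn_leq /= emin; last by case: pm.
    by case: pm => _ ->.
  have eET : e \in eset G :\: T by rewrite inE eT.
  have [s cs es] := fundamental_cycle wfG sT eET; have [f fmin] := cyc_edges_min es.
  exact: (cycle_value_lt0 TE duT eE cs es fmin (wmax e eE) (optC e eET s cs es f fmin)).
have opta e : e \in eset G -> e != p -> opt_at G w T u phi e.
  move=> eE ep; case: (eqVneq e w) => [ew|]; last exact: opt.
  by rewrite ew in eE ep *; apply: optw.
have [TE _ _] := sT; split=> // [b bT bmin X _ _ cutT bX tX f fmin|e].
  have /(opta b (subsetP TE b bT)) : b != p by apply/eqP => bp; apply: bmin; rewrite bp.
  rewrite /opt_at bT; apply: contraTN => tf.
  by rewrite -leNgt (cut_value_ge0 prT cutT bX tX fmin).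
rewrite inE => /andP[eT eE] s cs es f fmin.
have /(opta e eE) : e != p by apply: contraNneq eT => ->.
rewrite /opt_at (negPf eT) => lt_e; have [/cyc_edgesP[[] fs] _] := fmin => //.
by move: lt_e; rewrite ltNge (cycle_value_ge0 TE duT eE cs es fmin fs).
Qed.

End FullyOptimal.

(** * Comparison of two certified trees *)

Section Uniqueness.
Local Open Scope ring_scope.
Variables (V : finType) (m : nat) (G : digraph V m) (p w : 'I_m).
Variables (T S : {set 'I_m}) (u v : 'I_m -> int) (phi psi : V -> int).
Hypotheses (wfG : wf_digraph G).
Hypotheses (optT : near_opt G p w T u phi) (optS : near_opt G p w S v psi).

(** The summand [u v' + v u'], where a prime stands for weight minus tension. *)
Let gap e : int :=
  u e * (weight w e - dpot G psi e) + v e * (weight w e - dpot G phi e).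

(** Both circulation conditions are tested on [phi - psi]. The terms of the difference are the gaps,
    because [u u'] and [v v'] vanish at every edge by complementary supports. *)
Lemma gap_sum : \sum_(e in eset G) gap e = 0.
Proof.
have [_ [circT suppT] dualT _] := optT; have [_ [circS suppS] dualS _] := optS.
have := circT (fun x => phi x - psi x); rewrite -circS => /eqP.
rewrite -subr_eq0 -sumrB => /eqP sum0; rewrite -[RHS]sum0.
apply: eq_bigr => e eE; rewrite dpotB /gap.
case: (boolP (e \in T)) => eT; case: (boolP (e \in S)) => eS;
  rewrite ?(dualT e eT) ?(dualS e eS) ?(suppT e eE eT) ?(suppS e eE eS); lia.
Qed.

Lemma gap_eq0 e : e \in eset G -> (e \in T) = (e \in S) -> gap e = 0.
Proof.
have [_ [_ suppT] dualT _] := optT; have [_ [_ suppS] dualS _] := optS.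
move=> eE TS; rewrite /gap; case: (boolP (e \in T)) => eT; have := eT; rewrite TS => eS.
  by rewrite dualT ?dualS // !subrr !mulr0 addr0.
by rewrite suppT ?suppS // !mul0r addr0.
Qed.

Lemma gap_gt0 e : e \in eset G -> e != w -> (e \in T) != (e \in S) -> 0 < gap e.
Proof.
have [[_ pT] [_ suppT] dualT sgT] := optT; have [[_ pS] [_ suppS] dualS sgS] := optS.
move=> eE ew eTS; have ep : e != p by apply: contraNneq eTS => ->; rewrite pT pS.
have := sgS e eE ep ew; have := sgT e eE ep ew; rewrite /opt_at /gap.
case: (boolP (e \in T)) eTS => eT; case: (boolP (e \in S)) => // eS _ ltT ltS.
  by rewrite (suppS e eE eS) mul0r addr0 nmulr_lgt0 // subr_lt0.
by rewrite (suppT e eE eT) mul0r add0r nmulr_lgt0 // subr_lt0.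
Qed.

Lemma gap_ge0 e : e \in eset G -> e != w -> 0 <= gap e.
Proof.
move=> eE ew; case: (eqVneq (e \in T) (e \in S)) => [/(gap_eq0 eE)-> //|].
by move/(gap_gt0 eE ew)/ltW.
Qed.

Lemma gap_le0_agree : (w \in eset G -> 0 <= gap w) ->
  forall e, e \in eset G -> e != w -> (e \in T) = (e \in S).
Proof.
move=> gw e eE ew; apply/eqP/contraT => /(gap_gt0 eE ew).
rewrite (psumr_eq0P _ gap_sum) ?ltxx // => f fE.
by case: (eqVneq f w) => [fw|]; [rewrite fw in fE *; apply: gw | apply: gap_ge0].
Qed.

Lemma near_opt_unique : (w \in T) = (w \in S) -> T = S.
Proof.
move=> TSw; apply/setP => e; have [[[TE _ _] _] _ _ _] := optT.
have [[[SE _ _] _] _ _ _] := optS.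
case: (boolP (e \in eset G)) => [eE|eE]; last first.
  by rewrite (negPf (contra (subsetP TE e) eE)) (negPf (contra (subsetP SE e) eE)).
case: (eqVneq e w) => [-> //|ew]; apply: gap_le0_agree => // wE.
by rewrite gap_eq0.
Qed.

(** The product is the gap at [w]. Were it nonnegative, the trees would agree off [w]; then the
    potential dual to [w] in [S] would have zero tension on [T], hence also at [w], where its
    tension is 1. *)
Lemma near_opt_opposite : w \notin T -> w \in S ->
  v w * (weight w w - dpot G phi w) < 0.
Proof.
move=> wT wS; have [[sT _] [_ suppT] _ _] := optT; have [[sS _] _ _ _] := optS.
have [SE _ _] := sS; have wE := subsetP SE w wS.
have gapw : gap w = v w * (weight w w - dpot G phi w).
  by rewrite /gap suppT // mul0r add0r.
rewrite -gapw ltNge; apply/negP => gw; have TS := gap_le0_agree (fun _ => gw).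
have [_ _ indS] := (spanning_treeP S wfG).1 sS.
have [chi chi1 chi0] := indS w wS.
suff : dpot G chi w = dpot G (fun=> 0) w by rewrite chi1 /dpot subrr.
apply: (tree_pot_eq wfG sT) wE => b bT; have [TE _ _] := sT.
have bw : b != w by apply: contraNneq wT => <-.
by rewrite chi0 // -?TS ?(subsetP TE) // /dpot subrr.
Qed.

End Uniqueness.

(** * Certificates under deletion and contraction *)

Section Minors.
Local Open Scope ring_scope.
Variables (V : finType) (m : nat) (G : digraph V m) (p w : 'I_m).
Implicit Types (T : {set 'I_m}) (phi : V -> int).
Hypotheses (wfG : wf_digraph G) (wE : w \in eset G).

(** As the weight is 0 at [w], pairings with it lose nothing when passing to a minor. *)
Lemma sum_weight_del (f : 'I_m -> int) :
  \sum_(e in eset G) weight w e * f e = \sum_(e in eset G :\ w) weight w e * f e.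
Proof. by rewrite (big_setD1 w) //= weight_eq0 // mul0r add0r. Qed.

Lemma wf_delete : wf_digraph (delete G w).
Proof. by move=> e; rewrite inE => /andP[_]; apply: wfG. Qed.

Lemma wf_contract : wf_digraph (contract G w).
Proof.
move=> e; rewrite inE => /andP[_ /wfG[tV hV]].
by split; apply: imset_f.
Qed.

Lemma spanning_tree_delete T :
  spanning_tree (delete G w) T <-> spanning_tree G T /\ w \notin T.
Proof.
split=> [[TE conT indT]|[[TE conT indT] wT]].
  move: TE; rewrite /= subsetD1 => /andP[TE wT].
  by split.
by split; rewrite //= subsetD1 TE.
Qed.

(** For [w] outside [T], [u] is 0 at [w], so restricting it or extending it by 0 keeps the
    circulation condition; [near_opt] asks for no sign at [w]. *)
Lemma near_opt_delete T : (exists u phi, near_opt (delete G w) p w T u phi) <->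
  w \notin T /\ exists u phi, near_opt G p w T u phi.
Proof.
split=> [[u [phi [[sT pT] [circ supp] du opt]]]|].
  have [sGT wT] := (spanning_tree_delete T).1 sT; split=> //.
  exists (fun e => if e == w then 0 else u e), phi; split=> //.
    split=> [psi|e eE eT].
      rewrite sum_weight_del -[RHS]circ (big_setD1 w) //= eqxx mul0r add0r.
      by apply: eq_bigr => e; rewrite !inE => /andP[/negPf-> _].
    by case: eqP => // /eqP ew; apply: supp; rewrite // !inE ew.
  move=> e eE ep ew; have := opt e; rewrite /opt_at !inE (negPf ew) => -> //.
move=> [wT [u [phi [[sT pT] [circ supp] du opt]]]].
exists u, phi; split; first by split=> //; apply/spanning_tree_delete.
- split=> [psi|e]; last by rewrite inE => /andP[_]; apply: supp.
  by have := circ psi; rewrite sum_weight_del (big_setD1 w) //= supp // mul0r add0r.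
- by [].
- by move=> e; rewrite inE => /andP[_]; apply: opt.
Qed.

Hypothesis wloop : tail G w != head G w.

(** Pullback along the contraction; it yields exactly the potentials of [G] with zero tension at
    [w]. *)
Let lift phi v := phi (merge G w v).

Lemma dpot_lift phi e : dpot (contract G w) phi e = dpot G (lift phi) e.
Proof. by []. Qed.

Lemma dpot_lift_w phi : dpot G (lift phi) w = 0.
Proof. by rewrite /dpot /lift /merge eqxx; case: eqP => _; rewrite subrr. Qed.

Lemma lift_id phi : dpot G phi w = 0 -> lift phi =1 phi.
Proof.
move/eqP; rewrite subr_eq0 => /eqP tw v; rewrite /lift /merge.
by case: eqP => // ->.
Qed.

Lemma dpot_ext phi psi e : phi =1 psi -> dpot G phi e = dpot G psi e.
Proof. by move=> eq_phi; rewrite /dpot !eq_phi. Qed.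

(** Modulo lifted potentials, every potential is a multiple of this one. *)
Let tip v : int := (v == head G w)%:R.

Lemma dpot_tip : dpot G tip w = -1.
Proof. by rewrite /dpot /tip eqxx (negPf wloop). Qed.

Lemma dpot_decomp phi e :
  dpot G phi e = dpot G (lift phi) e - dpot G phi w * dpot G tip e.
Proof.
have H x : phi x = lift phi x - dpot G phi w * tip x.
  rewrite /lift /merge /tip; case: eqP => [->|_]; first by rewrite mulr1 /dpot; lia.
  by rewrite mulr0 subr0.
rewrite [LHS]/dpot (H (tail G e)) (H (head G e)).
by rewrite [dpot G (lift phi) e]/dpot [dpot G tip e]/dpot mulrBr; lia.
Qed.

Lemma spanning_tree_contract T :
  spanning_tree (contract G w) T <-> w \notin T /\ spanning_tree G (w |: T).
Proof.
split=> [sT|[wT sT]].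
  have /(spanning_treeP _ wf_contract)[TE constT indT] := sT.
  move: TE; rewrite /= subsetD1 => /andP[TE wT]; split=> //.
  apply/(spanning_treeP _ wfG); split; first by rewrite subUset sub1set wE.
    move=> phi phi0 x y xV yV; have phiw := phi0 w (setU11 _ _).
    rewrite -(lift_id phiw x) -(lift_id phiw y); apply: (constT phi); last 2 first.
    - exact: imset_f.
    - exact: imset_f.
    move=> e eT; rewrite dpot_lift (dpot_ext _ (lift_id phiw)).
    by apply: phi0; rewrite inE eT orbT.
  move=> b; rewrite !inE => /orP[/eqP->|bT]; last first.
    have [phi phi1 phi0] := indT b bT; exists (lift phi) => // e.
    rewrite !inE => /orP[/eqP-> _|]; [exact: dpot_lift_w | exact: phi0].
  pose X c := ind (comp (contract G w) (T :\ c) (tail (contract G w) c)).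
  (* [rep] combines fundamental cuts of the contraction so as to match [tip] on [T]; subtracting
     [tip] from its lift leaves tension 1 at [w] and 0 on [T]. *)
  pose rep v := \sum_(c in T) dpot G tip c * X c v.
  have repT c : c \in T -> dpot G (lift rep) c = dpot G tip c.
    move=> cT; rewrite -dpot_lift dpot_sum (bigD1 c) //=.
    have [_ _ X1 _] := tree_cut wf_contract sT cT.
    rewrite [dpot _ (X c) c]X1 mulr1 big1 ?addr0 // => f /andP[fT fb].
    have [_ _ _ X0] := tree_cut wf_contract sT fT.
    by rewrite X0 ?mulr0 // eq_sym.
  exists (fun v => lift rep v - tip v).
    by rewrite dpotB dpot_lift_w dpot_tip.
  move=> e; rewrite !inE => /orP[/eqP->|eT _]; first by rewrite eqxx.
  by rewrite dpotB repT ?subrr.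
have /(spanning_treeP _ wfG)[TE constT indT] := sT.
apply/(spanning_treeP _ wf_contract); split.
- by rewrite /= subsetD1 wT andbT; move: TE; rewrite subUset => /andP[].
- move=> phi phi0 x y /imsetP[x' xV ->] /imsetP[y' yV ->].
  apply: (constT (lift phi)) xV yV => e.
  by rewrite !inE => /orP[/eqP->|/phi0 //]; exact: dpot_lift_w.
move=> b bT; have [|phi phi1 phi0] := indT b; first by rewrite inE bT orbT.
have bw : b != w by apply: contraNneq wT => <-.
have phiw : dpot G phi w = 0 by apply: phi0; rewrite ?setU11 // eq_sym.
exists phi; first by rewrite dpot_lift (dpot_ext _ (lift_id phiw)).
move=> e eT eb; rewrite dpot_lift (dpot_ext _ (lift_id phiw)).
by apply: phi0; rewrite // inE eT orbT.
Qed.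

Lemma near_opt_contract T : p != w ->
  (exists u phi, near_opt (contract G w) p w T u phi) <->
  w \notin T /\ exists u phi, near_opt G p w (w |: T) u phi.
Proof.
move=> pw; split=> [[u [phi [[sT pT] [circ supp] du opt]]]|].
  have [wT sGT] := (spanning_tree_contract T).1 sT; split=> //.
  (* This value is forced by orthogonality of [weight w - u] to the tension of [tip], the one test
     missing in the contraction. *)
  pose uw := \sum_(e in eset G :\ w) (u e - weight w e) * dpot G tip e.
  exists (fun e => if e == w then uw else u e), (lift phi); split.
  - by split=> //; rewrite inE pT orbT.
  - split=> [psi|e eE]; last first.
      rewrite !inE negb_or => /andP[ew eT]; rewrite (negPf ew).
      by apply: supp; rewrite // !inE ew.
    rewrite sum_weight_del (big_setD1 w) //= eqxx.
    have circ_psi : \sum_(e in eset G :\ w) u e * dpot G (lift psi) e =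
        \sum_(e in eset G :\ w) weight w e * dpot G (lift psi) e := circ psi.
    rewrite (eq_bigr (fun e => u e * dpot G (lift psi) e -
                               dpot G psi w * (u e * dpot G tip e))); last first.
      move=> e; rewrite !inE => /andP[/negPf-> _].
      by rewrite (dpot_decomp psi e) mulrBr [u e * (_ * _)]mulrCA.
    rewrite [RHS](eq_bigr (fun e => weight w e * dpot G (lift psi) e -
      dpot G psi w * (weight w e * dpot G tip e))); last first.
      by move=> e _; rewrite (dpot_decomp psi e) mulrBr [weight w e * (_ * _)]mulrCA.
    have uwE : uw = \sum_(e in eset G :\ w) u e * dpot G tip e -
                    \sum_(e in eset G :\ w) weight w e * dpot G tip e.
      by rewrite -sumrB; apply: eq_bigr => e _; rewrite mulrBl.
    by rewrite !sumrB -!mulr_sumr circ_psi uwE; ring.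
  - move=> e; rewrite !inE => /orP[/eqP->|/du //].
    by rewrite dpot_lift_w weight_eq0.
  - move=> e eE ep ew; have := opt e; rewrite /opt_at !inE (negPf ew) => -> //.
move=> [wT [u [phi [[sT pT] [circ supp] du opt]]]].
exists u, phi; have duw : dpot G phi w = 0 by rewrite du ?setU11 ?weight_eq0.
split.
- split; first exact/spanning_tree_contract.
  by move: pT; rewrite !inE (negPf pw).
- split=> [psi|e]; last first.
    by rewrite !inE => /andP[ew eE] eT; apply: supp; rewrite // !inE negb_or ew.
  have := circ (lift psi); rewrite sum_weight_del (big_setD1 w) //=.
  by rewrite dpot_lift_w mulr0 add0r.
- move=> e eT; rewrite dpot_lift (dpot_ext _ (lift_id duw)).
  by apply: du; rewrite inE eT orbT.
- move=> e; rewrite !inE => /andP[ew eE] ep _; have := opt e eE ep ew.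
  by rewrite /opt_at !inE (negPf ew) /= dpot_lift (dpot_ext _ (lift_id duw)).
Qed.

Hypotheses (pmin : is_min (eset G) p) (wmax : forall e, e \in eset G -> (e <= w)%N).
Hypothesis pw : p != w.

(** Since [w] is not an edge of the minor, full optimality there is [near_opt] alone, and this
    transfers to [G]. *)
Lemma fully_optimal_delete T : fully_optimal (delete G w) T <->
  w \notin T /\ exists u phi, near_opt G p w T u phi.
Proof.
have pm : is_min (eset (delete G w)) p.
  by case: pmin => pE ple; split=> [|f]; rewrite inE ?inE ?pw // => /andP[_ /ple].
rewrite -near_opt_delete (fully_optimalP wf_delete T pm); last first.
  by move=> e; rewrite inE => /andP[_]; apply: wmax.
split=> [[u [phi []]]|[u [phi]]]; exists u, phi => //; split=> //.
by rewrite !inE eqxx.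
Qed.

Lemma fully_optimal_contract T : fully_optimal (contract G w) T <->
  w \notin T /\ exists u phi, near_opt G p w (w |: T) u phi.
Proof.
have pm : is_min (eset (contract G w)) p.
  by case: pmin => pE ple; split=> [|f]; rewrite inE ?inE ?pw // => /andP[_ /ple].
rewrite -near_opt_contract // (fully_optimalP wf_contract T pm); last first.
  by move=> e; rewrite inE => /andP[_]; apply: wmax.
split=> [[u [phi []]]|[u [phi]]]; exists u, phi => //; split=> //.
by rewrite !inE eqxx.
Qed.

End Minors.

(** * Bipolar digraphs and the obstructions in their minors *)

Section Bipolar.
Local Open Scope ring_scope.
Variables (V : finType) (m : nat).
Implicit Types (G : digraph V m) (T : {set 'I_m}) (phi : V -> int).

Lemma acyclic_loopless G e : acyclic G -> e \in eset G -> tail G e != head G e.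
Proof.
move=> acG eE; apply/eqP => th; apply: (acG [:: (e, true)]) => //.
by split; rewrite //= ?eE // /send /sstart /= th.
Qed.

(** Pairing with a strictly positive tension gives nonnegative terms of sum 0. *)
Lemma acyclic_no_circulation G (z : 'I_m -> int) : acyclic G ->
  (forall phi, \sum_(e in eset G) z e * dpot G phi e = 0) ->
  (forall e, e \in eset G -> 0 <= z e) -> forall e, e \in eset G -> z e = 0.
Proof.
move=> /acyclic_potential[phi phi_gt0] circ z_ge0 e eE.
have z0 f : f \in eset G -> 0 <= z f * dpot G phi f.
  by move=> fE; rewrite mulr_ge0 ?z_ge0 // ltW ?phi_gt0.
have /eqP := psumr_eq0P z0 (circ phi) eE.
by rewrite mulf_eq0 (gt_eqF (phi_gt0 e eE)) orbF => /eqP.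
Qed.

Lemma acyclic_delete G w : acyclic G -> acyclic (delete G w).
Proof.
move=> acG s [snil sE us uv ends]; apply: acG; split=> //.
by apply: sub_all sE => x; rewrite inE => /andP[].
Qed.

Lemma acyclic_source G v : v \in vset G -> acyclic G -> wf_digraph G ->
  exists x, is_source G x.
Proof.
move=> vV /acyclic_potential[phi phi_gt0] wfG.
case: (arg_maxP phi vV) => x xV xmax; exists x; split=> // e eE.
apply/eqP => hx; have := phi_gt0 e eE; rewrite /dpot hx subr_gt0 ltNge.
by have [tV _] := wfG e eE; have /= -> := xmax _ tV.
Qed.

Lemma acyclic_sink G v : v \in vset G -> acyclic G -> wf_digraph G ->
  exists x, is_sink G x.
Proof.
move=> vV /acyclic_potential[phi phi_gt0] wfG.
case: (arg_minP phi vV) => x xV xmin; exists x; split=> // e eE.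
apply/eqP => tx; have := phi_gt0 e eE; rewrite /dpot tx subr_gt0 ltNge.
by have [_ hV] := wfG e eE; have /= -> := xmin _ hV.
Qed.

Variables (G : digraph V m) (p w : 'I_m).
Hypotheses (wfG : wf_digraph G) (bipG : bipolar G p).
Hypotheses (wE : w \in eset G) (pw : p != w).

Let wloop : tail G w != head G w.
Proof. by case: bipG => _ acG _ _; apply: acyclic_loopless. Qed.

(* Deleting [w] destroys bipolarity only by creating a new source or sink;
   its star is a cocycle whose only negative edge is [w]. *)
Lemma bipolar_delete :
  (forall phi, dpot G phi w < 0 -> dpot G phi p = 0 ->
     (forall e, e \in eset G :\ w -> 0 <= dpot G phi e) ->
     ~ exists2 f, f \in eset G :\ w & 0 < dpot G phi f) ->
  bipolar (delete G w) p.
Proof.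
have [pE acG srcG snkG] := bipG; move=> no_pot.
have pEw : p \in eset G :\ w by rewrite !inE pw.
have [[tpV tpS] [hpV hpS]] := ((srcG (tail G p)).2 erefl, (snkG (head G p)).2 erefl).
split; rewrite //; first exact: acyclic_delete.
  move=> v; split=> [[vV vS]|->]; last first.
    by split=> // e; rewrite inE => /andP[_]; apply: tpS.
  apply/eqP/contraT => vp; exfalso.
  have hwv : head G w = v.
    apply/eqP; apply: contraNT vp => hwv; apply/eqP/srcG; split=> // e eE.
    by case: (eqVneq e w) => [->|ew] //; apply: vS; rewrite !inE ew.
  have dv e : e \in eset G :\ w -> dpot G (fun x => (x == v)%:R) e = (tail G e == v)%:R.
    by move=> /vS /negPf hev; rewrite /dpot hev subr0.
  apply: (no_pot (fun x => (x == v)%:R)) => [||e eEw|].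
  - by rewrite /dpot -hwv eqxx (negPf wloop).
  - by rewrite dv // eq_sym (negPf vp).
  - by rewrite dv // ler0n.
  case: (boolP [exists f in eset G :\ w, tail G f == v]) => [/existsP[f /andP[fE tf]]|].
    by exists f; rewrite // dv // tf.
  (* Otherwise [v] would be a sink of [G], hence the head of [p], although no edge but [w] enters
     it. *)
  rewrite negb_exists => /forallP not_tail; have := vS p pEw.
  have -> : head G p = v; last by rewrite eqxx.
  apply/esym/snkG; split=> // e eE; case: (eqVneq e w) => [->|ew].
    by rewrite -hwv.
  by have := not_tail e; rewrite !inE ew eE.
move=> v; split=> [[vV vS]|->]; last first.
  by split=> // e; rewrite inE => /andP[_]; apply: hpS.
apply/eqP/contraT => vp; exfalso.
have twv : tail G w = v.
  apply/eqP; apply: contraNT vp => twv; apply/eqP/snkG; split=> // e eE.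
  by case: (eqVneq e w) => [->|ew] //; apply: vS; rewrite !inE ew.
(* For a new sink the indicator is negated, so that [w] is again the only negative edge. *)
have dv e : e \in eset G :\ w -> dpot G (fun x => - (x == v)%:R) e = (head G e == v)%:R.
  by move=> /vS /negPf tev; rewrite /dpot tev oppr0 opprK add0r.
apply: (no_pot (fun x => - (x == v)%:R)) => [||e eEw|].
- by rewrite /dpot -twv eqxx eq_sym (negPf wloop).
- by rewrite dv // eq_sym (negPf vp).
- by rewrite dv // ler0n.
case: (boolP [exists f in eset G :\ w, head G f == v]) => [/existsP[f /andP[fE hf]]|].
  by exists f; rewrite // dv // hf.
rewrite negb_exists => /forallP not_head; have := vS p pEw.
have -> : tail G p = v; last by rewrite eqxx.
apply/esym/srcG; split=> // e eE; case: (eqVneq e w) => [->|ew].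
  by rewrite -twv eq_sym.
by have := not_head e; rewrite !inE ew eE.
Qed.

(** Orthogonality to lifted potentials is inherited; [zw] is solved from orthogonality to [tip]. *)
Lemma contract_circulation (z : 'I_m -> int) :
  (forall phi, \sum_(e in eset G :\ w) z e * dpot (contract G w) phi e = 0) ->
  exists zw, forall phi,
    \sum_(e in eset G) (if e == w then zw else z e) * dpot G phi e = 0.
Proof.
move=> circ; pose tip (v : V) : int := (v == head G w)%:R.
pose zw := \sum_(e in eset G :\ w) z e * dpot G tip e; exists zw => phi.
rewrite (big_setD1 w) //= eqxx.
rewrite (eq_bigr (fun e => z e * dpot (contract G w) phi e -
                           dpot G phi w * (z e * dpot G tip e))).
  by rewrite sumrB circ -mulr_sumr -/zw; ring.
move=> e; rewrite !inE => /andP[/negPf-> _].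
by rewrite (dpot_decomp wE wloop phi e) mulrBr [z e * (_ * _)]mulrCA.
Qed.

(* A directed cycle of the contraction lifts to a circulation whose only
   negative entry can be at [w]; new sources or sinks do not arise otherwise. *)
Lemma bipolar_contract :
  (forall z : 'I_m -> int,
     (forall phi, \sum_(e in eset G) z e * dpot G phi e = 0) -> z w < 0 ->
     (forall e, e \in eset G :\ w -> 0 <= z e) ->
     ~ exists2 f, f \in eset G :\ w & 0 < z f) ->
  bipolar (contract G w) p.
Proof.
have [pE acG srcG snkG] := bipG; move=> no_circ.
have pEw : p \in eset G :\ w by rewrite !inE pw.
have wfC : wf_digraph (contract G w) := wf_contract wfG.
have acC : acyclic (contract G w).
  move=> s cs; have [snil sE us _ _] := cs => spos.
  have [zw circ] := contract_circulation (fun phi => sum_cyc_dpot phi cs).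
  have s_ge0 e : 0 <= cyc_vec s e.
    rewrite /cyc_vec; have /negPf-> : (e, false) \notin s.
      by apply/negP => /(allP spos).
    by rewrite subr0 ler0n.
  case: s {snil} cs sE us spos circ s_ge0 (snil) => [//|[f b] s] cs sE us spos circ s_ge0 _.
  have fE : f \in eset G :\ w by have /andP[] := sE.
  have fs : (f, true) \in (f, b) :: s by have /andP[/= -> _] := spos; rewrite mem_head.
  have sf := cyc_vec_mem us fs; have fw : f != w by move: fE; rewrite !inE => /andP[].
  case: (ltP zw 0) => [zw_lt0|zw_ge0].
    apply: (no_circ _ circ); first by rewrite eqxx.
      by move=> e; rewrite !inE => /andP[/negPf-> _].
    by exists f; rewrite // (negPf fw) sf.
  (* With a nonnegative value at [w], the lift is a nonnegative circulation in an acyclic digraph,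
     hence 0, against its value 1 at [f]. *)
  have /setD1P[_ fG] := fE; suff /eqP : sgb true = 0 by [].
  have := acyclic_no_circulation acG circ _ fG; rewrite (negPf fw) sf; apply=> e _.
  by case: ifP.
have merge_tw : merge G w (tail G w) = tail G w by rewrite /merge (negPf wloop).
have merge_neq x : merge G w x != head G w.
  by rewrite /merge; case: (eqVneq x (head G w)).
have [twV hwV] := wfG wE.
(* A source of the contraction comes from a source of [G]. If it is the merged vertex, no edge but
   [w] enters either end of [w], so [tail G w] is a source; for sinks, [head G w] takes this
   role. *)
have srcC v : is_source (contract G w) v -> v = tail (contract G w) p.
  case=> /imsetP[x xV ->]; move: (merge_neq x) => vh vS /=.
  case: (eqVneq (merge G w x) (tail G w)) => [vt|vt].
    rewrite vt in vS *; have <- // : tail G w = tail G p.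
    apply/srcG; split=> // e eE; case: (eqVneq e w) => [->|ew]; first by rewrite eq_sym.
    have : e \in eset (contract G w) by rewrite !inE ew.
    by move/vS => /=; apply: contraNneq => ->; rewrite merge_tw.
  have mx : merge G w x = x.
    by move: vt; rewrite /merge; case: (x == head G w); rewrite ?eqxx.
  rewrite mx in vS vt vh *; have <- // : x = tail G p.
  apply/srcG; split=> // e eE; case: (eqVneq e w) => [->|ew]; first by rewrite eq_sym.
  have : e \in eset (contract G w) by rewrite !inE ew.
  by move/vS => /=; apply: contraNneq => ->; rewrite mx.
have snkC v : is_sink (contract G w) v -> v = head (contract G w) p.
  case=> /imsetP[x xV ->]; move: (merge_neq x) => vh vS /=.
  case: (eqVneq (merge G w x) (tail G w)) => [vt|vt].
    rewrite vt in vS *; have <- : head G w = head G p; last by rewrite /merge eqxx.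
    apply/snkG; split=> // e eE; case: (eqVneq e w) => [-> //|ew].
    have : e \in eset (contract G w) by rewrite !inE ew.
    by move/vS => /=; apply: contraNneq => ->; rewrite /merge eqxx.
  have mx : merge G w x = x.
    by move: vt; rewrite /merge; case: (x == head G w); rewrite ?eqxx.
  rewrite mx in vS vt vh *; have <- // : x = head G p.
  apply/snkG; split=> // e eE; case: (eqVneq e w) => [->|ew]; first by rewrite eq_sym.
  have : e \in eset (contract G w) by rewrite !inE ew.
  by move/vS => /=; apply: contraNneq => ->; rewrite mx.
(* Acyclicity provides some source and some sink, so the only candidates are indeed such. *)
have tV : tail (contract G w) p \in vset (contract G w) by case: (wfC p pEw).
split=> // v; split=> [|->]; first exact: srcC.
- by have [x xS] := acyclic_source tV acC wfC; rewrite -(srcC x xS).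
- exact: snkC.
- by have [x xS] := acyclic_sink tV acC wfC; rewrite -(snkC x xS).
Qed.

(** * The sign at [w] forced by a minor that is not bipolar *)

Section NotBipolar.
Variables (T : {set 'I_m}) (u : 'I_m -> int) (phi : V -> int).
Hypotheses (wmax : forall e, e \in eset G -> (e <= w)%N).
Hypothesis optT : near_opt G p w T u phi.

Let weight_pos e : e \in eset G :\ w -> 0 < weight w e.
Proof.
rewrite !inE => /andP[ew eE]; apply: weight_gt0; rewrite ltn_neqAle wmax // andbT.
by apply: contraNneq ew => /val_inj->.
Qed.

Let sum_weight_gt0 (d : 'I_m -> int) : (forall e, e \in eset G :\ w -> 0 <= d e) ->
  (exists2 f, f \in eset G :\ w & 0 < d f) ->
  0 < \sum_(e in eset G) weight w e * d e.
Proof.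
move=> d_ge0 [f fE df]; rewrite sum_weight_del // (bigD1 f) //=.
apply: ltr_pwDl; first by rewrite mulr_gt0 ?weight_pos.
by apply: sumr_ge0 => e /andP[eE _]; rewrite mulr_ge0 ?d_ge0 // ltW ?weight_pos.
Qed.

Let opt_le0 e : e \in eset G -> e != p -> e != w ->
  u e <= 0 /\ weight w e - dpot G phi e <= 0.
Proof.
have [_ [_ supp] du opt] := optT; move=> eE ep ew.
have := opt e eE ep ew; rewrite /opt_at; case: ifPn => eT ltT.
  by rewrite du // subrr ltW.
by split; [rewrite supp | rewrite subr_le0 ltW].
Qed.

(** The tension of [psi], negative only at [w], has a positive pairing with the weight. This equals
    its pairing with [u], where [u w >= 0] would make every term at most 0; at [p], where [u] has no
    prescribed sign, the tension vanishes. *)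
Lemma delete_not_bipolar_opt : ~ bipolar (delete G w) p -> u w < 0.
Proof.
have [_ [circ _] _ _] := optT; move=> nbip; apply: contraT; rewrite -leNgt => uw.
case: nbip; apply: bipolar_delete => psi psiw psip psi_ge0 psi_gt0.
have := sum_weight_gt0 psi_ge0 psi_gt0; rewrite -circ ltNge => /negP; apply.
apply: sumr_le0 => e eE; case: (eqVneq e w) => [->|ew].
  by rewrite mulr_ge0_le0 // ltW.
case: (eqVneq e p) => [->|ep]; first by rewrite psip mulr0.
by rewrite mulr_le0_ge0 ?psi_ge0 ?inE ?ew //; case: (opt_le0 eE ep ew).
Qed.

(** The same argument with a circulation paired with [weight w - dpot G phi]; the term at [p] now
    vanishes because [p] lies in [T]. *)
Lemma contract_not_bipolar_opt : ~ bipolar (contract G w) p -> weight w w < dpot G phi w.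
Proof.
have [[_ pT] _ du _] := optT; move=> nbip; apply: contraT; rewrite -leNgt => phiw.
case: nbip; apply: bipolar_contract => z circ zw z_ge0 z_gt0.
have := sum_weight_gt0 z_ge0 z_gt0; rewrite ltNge => /negP; apply.
have <- : \sum_(e in eset G) weight w e * z e - \sum_(e in eset G) z e * dpot G phi e =
    \sum_(e in eset G) weight w e * z e by rewrite circ subr0.
rewrite -sumrB; apply: sumr_le0 => e eE.
rewrite mulrC -mulrBr; case: (eqVneq e w) => [->|ew].
  by rewrite mulr_le0_ge0 ?subr_ge0 // ltW.
case: (eqVneq e p) => [->|ep]; first by rewrite du // subrr mulr0.
by rewrite mulr_ge0_le0 ?z_ge0 ?inE ?ew //; case: (opt_le0 eE ep ew).
Qed.

End NotBipolar.
End Bipolar.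

(** * Choice between deletion and contraction *)

Section Recursion.
Local Open Scope ring_scope.
Variables (V : finType) (m : nat) (G : digraph V m) (p w : 'I_m).
Implicit Types (T : {set 'I_m}).
Hypotheses (wfG : wf_digraph G) (bipG : bipolar G p) (pmin : is_min (eset G) p).
Hypotheses (wmax : is_max (eset G) w).

Lemma fully_optimal_single : connected G -> eset G = [set w] ->
  alpha_is G (fun T => T = [set w]).
Proof.
move=> [_ conG] Ew T; have pw : p = w by apply/eqP; case: pmin; rewrite Ew inE.
split=> [optT|->].
  apply/eqP; rewrite eqEsubset sub1set -{2}pw (fully_optimal_min wfG pmin optT) andbT.
  by rewrite -Ew; case: optT => -[].
have wE : w \in eset G by rewrite Ew set11.
have wloop : tail G w != head G w by case: bipG => _ acG _ _; apply: acyclic_loopless.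
split; first split; first by rewrite Ew.
- by rewrite -Ew.
- move=> e /set1P->; rewrite setDv; apply: contra wloop => twh; apply/eqP.
  have := connect_pot (phi := fun x => (x == tail G w)%:R) _ twh; rewrite eqxx.
  have H e0 : e0 \in set0 -> dpot G (fun x => (x == tail G w)%:R) e0 = 0 by rewrite inE.
  by move=> /(_ H); case: (eqVneq (head G w) (tail G w)).
- by move=> b /set1P-> nmin; case: nmin; rewrite -pw.
by move=> e; rewrite Ew setDv inE.
Qed.

Hypothesis pw : p != w.

Let wE : w \in eset G. Proof. by case: wmax. Qed.
Let wle e : e \in eset G -> (e <= w)%N. Proof. by case: wmax => _; apply. Qed.
Let wloop : tail G w != head G w.
Proof. by case: bipG => _ acG _ _; apply: acyclic_loopless. Qed.

Lemma fully_optimal_near T : fully_optimal G T <->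
  exists u phi, near_opt G p w T u phi /\ opt_at G w T u phi w.
Proof.
rewrite (fully_optimalP wfG T pmin wle).
split=> -[u [phi [opt optw]]]; exists u, phi; split=> //.
by apply: optw; rewrite // eq_sym.
Qed.

(** The optimal trees of the deletion are the [near_opt] trees avoiding [w]. The premises say that
    these have the right sign at [w] and that every optimal tree of [G] avoids [w]. *)
Lemma alpha_delete : (forall T u phi, near_opt G p w T u phi -> w \notin T ->
    weight w w < dpot G phi w) ->
  (forall T, fully_optimal G T -> w \notin T) ->
  alpha_is G (fun T => fully_optimal (delete G w) T).
Proof.
move=> opt_out out T; rewrite (fully_optimal_delete wfG wE pmin wle pw).
split=> [optT|[wT [u [phi optT]]]].
  split; first exact: out.
  by have /fully_optimal_near[u [phi [? _]]] := optT; exists u, phi.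
apply/fully_optimal_near; exists u, phi; split=> //.
by rewrite /opt_at (negPf wT) (opt_out T u phi).
Qed.

Lemma alpha_contract : (forall T u phi, near_opt G p w T u phi -> w \in T -> u w < 0) ->
  (forall T, fully_optimal G T -> w \in T) ->
  alpha_is G (fun T => exists2 T2, fully_optimal (contract G w) T2 & T = w |: T2).
Proof.
move=> opt_in inT T; split=> [optT|[T2]].
  have wT := inT T optT; have eT := setD1K wT; exists (T :\ w); last by rewrite eT.
  apply/(fully_optimal_contract wfG wE wloop pmin wle pw); rewrite setD11 eT; split=> //.
  by have /fully_optimal_near[u [phi [? _]]] := optT; exists u, phi.
move=> /(fully_optimal_contract wfG wE wloop pmin wle pw)[_ [u [phi optT]]] ->.
apply/fully_optimal_near; exists u, phi; split=> //.
by rewrite /opt_at setU11 (opt_in _ u phi optT) ?setU11.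
Qed.

Section Exchange.
Variables (T S : {set 'I_m}) (u v : 'I_m -> int) (phi psi : V -> int).
Hypotheses (optT : near_opt G p w T u phi) (wT : w \notin T).
Hypotheses (optS : near_opt G p w S v psi) (wS : w \in S).

(** Exactly one of the two trees satisfies the sign condition at [w]. *)
Lemma near_opt_dichotomy :
  (weight w w < dpot G phi w) && (0 < v w) || (dpot G phi w < weight w w) && (v w < 0).
Proof.
have := near_opt_opposite wfG optT optS wT wS.
case: (ltgtP (v w) 0) => [vw|vw|->]; last by rewrite mul0r ltxx.
  by rewrite nmulr_rlt0 // subr_gt0 => ->; rewrite orbT.
by rewrite pmulr_rlt0 // subr_lt0 => ->.
Qed.

End Exchange.

End Recursion.

Theorem theorem3p2 (V : finType) (m : nat) (G : digraph V m) (p w : 'I_m) :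
  wf_digraph G -> connected G ->
  is_min (eset G) p -> bipolar G p -> is_max (eset G) w ->
  (* (a) *)
  (#|eset G| = 1 -> alpha_is G (fun T => T = [set w])) /\
  (1 < #|eset G| ->
   (* (b) *)
   (bipolar (contract G w) p -> ~ bipolar (delete G w) p ->
      alpha_is G (fun T => exists2 T2, fully_optimal (contract G w) T2
                                      & T = w |: T2)) /\
   (* (c) *)
   (bipolar (delete G w) p -> ~ bipolar (contract G w) p ->
      alpha_is G (fun T => fully_optimal (delete G w) T)) /\
   (bipolar (delete G w) p -> bipolar (contract G w) p ->
    (* (d) *)
    (forall T1, fully_optimal (delete G w) T1 ->
     forall s, signed_cycle_in G (w |: T1) s -> (w, true) \in s ->
     forall e, is_min (cyc_edges s) e ->
       ((e, false) \in s ->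
          alpha_is G (fun T => fully_optimal (delete G w) T)) /\
       ((e, true) \in s ->
          alpha_is G (fun T => exists2 T2, fully_optimal (contract G w) T2
                                          & T = w |: T2))) /\
    (* (e) *)
    (forall T2, fully_optimal (contract G w) T2 ->
     forall X : {set V}, X \subset vset G -> is_cocycle G (cut G X) ->
       cut G X \subset (eset G :\: (w |: T2)) :|: [set w] ->
       w \in cut G X -> tail G w \in X ->
     forall e, is_min (cut G X) e ->
       (tail G e \notin X ->
          alpha_is G (fun T => exists2 T2', fully_optimal (contract G w) T2'
                                           & T = w |: T2')) /\
       (tail G e \in X ->
          alpha_is G (fun T => fully_optimal (delete G w) T))))).
Proof.
move=> wfG conG pmin bipG wmax; split=> [E1|E2].
  apply: (fully_optimal_single wfG bipG pmin conG); have [wE _] := wmax.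
  by apply/eqP; rewrite eq_sym eqEcard sub1set wE cards1 E1.
have [wE wle] := wmax; have [pE ple] := pmin; have [_ acG _ _] := bipG.
have wloop := acyclic_loopless acG wE.
have pw : p != w.
  apply: contraTneq E2 => pw; rewrite -leqNgt -(cards1 w); apply/subset_leq_card.
  apply/subsetP => e eE; rewrite inE; apply/eqP/val_inj/eqP.
  by rewrite eqn_leq /= wle //= -pw ple.
have unique T S u phi v psi := @near_opt_unique V m G p w T S u v phi psi.
split; [move=> _ nbip | split; [move=> _ nbip | move=> _ _; split]].
- apply: (alpha_contract wfG bipG pmin wmax pw) => [T u phi optT _|T].
    exact: delete_not_bipolar_opt optT nbip.
  case/(fully_optimal_near wfG pmin wmax pw) => u [phi [optT _]].
  (* An optimal tree avoiding [w] would have [u w = 0], against the forced sign. *)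
  apply: contraT => wT; have := delete_not_bipolar_opt bipG wE pw wle optT nbip.
  by have [_ [_ ->]] := optT.
- apply: (alpha_delete wfG pmin wmax pw) => [T u phi optT _|T].
    exact: contract_not_bipolar_opt optT nbip.
  case/(fully_optimal_near wfG pmin wmax pw) => u [phi [optT _]].
  apply/negP => wT; have := contract_not_bipolar_opt wfG bipG wE pw wle optT nbip.
  by have [_ _ -> //] := optT; rewrite ltxx.
- move=> T1 /(fully_optimal_delete wfG wE pmin wle pw)[wT1 [u [phi opt1]]] s cs ws e emin.
  (* A [near_opt] tree avoiding [w] equals [T1] by uniqueness, so its sign at [w] is read from the
     given cycle; one containing [w] is compared with [T1] by the dichotomy. *)
  have [[[TE _ _] _] _ du1 _] := opt1; split=> es.
    apply: (alpha_delete wfG pmin wmax pw) => [T u' phi' optT wT|T].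
      have eT : T = T1 by apply: unique optT opt1 _; rewrite (negPf wT) (negPf wT1).
      have [_ _ du' _] := optT; rewrite eT in du'.
      exact: (cycle_value_lt0 TE du' wE cs ws emin (leqnn w) es).
    case/(fully_optimal_near wfG pmin wmax pw) => v [psi [optT sgT]]; apply/negP => wT.
    have lt1 := cycle_value_lt0 TE du1 wE cs ws emin (leqnn w) es.
    have := near_opt_dichotomy wfG opt1 wT1 optT wT; move: sgT; rewrite /opt_at wT => vw.
    by rewrite (lt_gtF lt1) (lt_gtF vw) andbF.
  apply: (alpha_contract wfG bipG pmin wmax pw) => [T v psi optT wT|T].
    have le1 := cycle_value_ge0 TE du1 wE cs ws emin es.
    have := near_opt_dichotomy wfG opt1 wT1 optT wT.
    by rewrite ltNge le1 => /andP[].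
  case/(fully_optimal_near wfG pmin wmax pw) => v [psi [optT]]; apply: contraLR => wT.
  have eT : T = T1 by apply: unique optT opt1 _; rewrite (negPf wT) (negPf wT1).
  have [_ _ du' _] := optT; rewrite /opt_at (negPf wT) -leNgt; rewrite eT in du'.
  exact: (cycle_value_ge0 TE du' wE cs ws emin es).
move=> T2 /(fully_optimal_contract wfG wE wloop pmin wle pw)[wT2 [v [psi opt2]]].
move=> X XV cX cutX wX tX e emin; have [_ pr2 _ _] := opt2.
(* Dually, [near_opt] trees containing [w] equal [w |: T2] and take their sign at [w] from the given
   cut; those avoiding [w] are compared with it by the dichotomy. *)
have wS := setU11 w T2; split=> te.
  apply: (alpha_contract wfG bipG pmin wmax pw) => [T u phi optT wT|T].
    have eT : T = w |: T2 by apply: unique optT opt2 _; rewrite wT wS.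
    have [_ prT _ _] := optT; rewrite eT in prT.
    exact: (cut_value_lt0 prT (leqnn w) cutX wX tX emin te).
  case/(fully_optimal_near wfG pmin wmax pw) => u [phi [optT sgT]]; apply: contraT => wT.
  have lt2 := cut_value_lt0 pr2 (leqnn w) cutX wX tX emin te.
  have := near_opt_dichotomy wfG optT wT opt2 wS; move: sgT.
  by rewrite /opt_at (negPf wT) => lt1; rewrite (lt_gtF lt1) (lt_gtF lt2) andbF.
have ge2 := cut_value_ge0 pr2 cutX wX tX emin te.
apply: (alpha_delete wfG pmin wmax pw) => [T u phi optT wT|T].
  have := near_opt_dichotomy wfG optT wT opt2 wS.
  by rewrite [(v w < 0)%R]ltNge ge2 andbF orbF => /andP[].
case/(fully_optimal_near wfG pmin wmax pw) => u [phi [optT sgT]]; apply/negP => wT.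
have eT : T = w |: T2 by apply: unique optT opt2 _; rewrite wT wS.
move: sgT; have [_ prT _ _] := optT; rewrite /opt_at wT ltNge; rewrite eT in prT.
by rewrite (cut_value_ge0 prT cutX wX tX emin te).
Qed.
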